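(* Let $G$ be a finitely generated group, let $\mathcal{S}$ be an ordered finite generating set of $G$ having Property $F$, and let $\mathcal{A}$ be the twisted generating set of $\mathcal{S}$. Then $\mathcal{S}$ defines a Dehornoy-like ordering of $G$ if and only if $\mathcal{A}$ defines an isolated left ordering of $G$.
   Context: A left ordering of $G$ is a total order $<$ with $g<g' \Rightarrow hg<hg'$; its positive cone is $P=\{g\in G : 1<g\}$. A subset $P\subset G$ is the positive cone of a left ordering iff $P\cdot P\subset P$ and $G=P\sqcup\{1\}\sqcup P^{-1}$; the ordering is then $h<g \iff h^{-1}g\in P$. The set $\mathrm{LO}(G)$ of left orderings is topologized as a subspace of $2^{G-\{1\}}$ (product topology, $2$ discrete) by identifying an ordering with its positive cone. An isolated ordering is a left ordering that is an isolated point of $\mathrm{LO}(G)$. Let $\mathcal{S}=\{s_1,\dots,s_n\}$ be an ordered finite generating set of $G$. The word-positive monoid $P_{\mathcal{S}}$ is the set of elements represented by nonempty words in $s_1,\dots,s_n$ (no inverses). A word on $\mathcal{S}\cup\mathcal{S}^{-1}$ is $i$-positive if it contains at least one $s_i$ and contains none of $s_1^{\pm1},\dots,s_{i-1}^{\pm1},s_i^{-1}$. An element is $\sigma(\mathcal{S})$-positive if it is represented by an $i$-positive word for some $1\le i\le n$; the set of such elements is $\Sigma_{\mathcal{S}}$. $\mathcal{S}$ defines a Dehornoy-like ordering if $\Sigma_{\mathcal{S}}$ is the positive cone of a left ordering of $G$. A finite generating set $\mathcal{A}$ defines an isolated ordering if $P_{\mathcal{A}}$ is the positive cone of an isolated left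 ordering. The twisted generating set of $\mathcal{S}$ is the ordered generating set $\mathcal{A}=\{a_1,\dots,a_n\}$ with $a_i=(s_is_{i+1}\cdots s_n)^{(-1)^{n-i+1}}$. Write $\mathcal{A}^{(i)}=\{a_i,\dots,a_n\}$ and $P_{\mathcal{A}}^{(i)}=P_{\mathcal{A}^{(i)}}$ (elements represented by nonempty words in $a_i,\dots,a_n$). $\mathcal{S}$ has Property $F$ if for all $1\le i\le n-1$: $a_i\,(P_{\mathcal{A}}^{(i+1)})^{-1}a_i^{-1}\subset P_{\mathcal{A}}^{(i)}$ and $a_i^{-1}(P_{\mathcal{A}}^{(i+1)})^{-1}a_i\subset P_{\mathcal{A}}^{(i)}$. *)

(* Defs.v *)
From mathcomp Require Import all_boot.
From mathcomp Require Import all_classical topology.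

Set Implicit Arguments.
Unset Strict Implicit.
Unset Printing Implicit Defensive.

Local Open Scope classical_set_scope.
Local Open Scope group_scope.

Section LeftOrderings.
Variable G : groupType.

Definition left_ordering (lt : rel G) : Prop :=
  [/\ irreflexive lt,
      transitive lt,
      forall g g' : G, g != g' -> lt g g' || lt g' g
    & forall h g g' : G, lt g g' -> lt (h * g) (h * g')].

Definition positive_cone (lt : rel G) : set G := [set g | lt 1 g].

Definition cone_of_left_ordering (P : set G) : Prop :=
  exists2 lt : rel G, left_ordering lt & P = positive_cone lt.

(* The space 2^(G - {1}), with the product topology; bool is discrete. *)
Definition cone_space : topologicalType := {ptws {g : G | g != 1} -> bool}.

Definition cone_point (lt : rel G) : cone_space := fun g => lt 1 (val g).

Definition LO : set cone_space := [set cone_point lt | lt in left_ordering].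

(* [isolated LO c] refers to neighbourhoods of c in the ambient space
   intersected with LO, that is, to the subspace topology of LO. *)
Definition isolated_ordering (lt : rel G) : Prop :=
  left_ordering lt /\ isolated LO (cone_point lt).

(* Elements represented by nonempty words in A, without inverses. *)
Definition word_positive (A : set G) : set G :=
  [set g | exists w : seq G,
     [/\ w != [::], forall x, x \in w -> A x & g = \prod_(x <- w) x]].

Definition defines_isolated_ordering (A : set G) : Prop :=
  exists2 lt : rel G, isolated_ordering lt & word_positive A = positive_cone lt.

End LeftOrderings.

(* An ordered family (s_1, ..., s_n) is represented by s : 'I_n -> G, so indices
   are shifted by one: s_i is the value of s at the ordinal i - 1. *)
Section OrderedGeneratingSets.
Variables (G : groupType) (n : nat).
Implicit Types (s a : 'I_n -> G) (w : seq ('I_n * bool)).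

(* Words are formal: the letter (j, false) stands for s_j and (j, true) for its
   inverse, even when different letters have the same value in G. *)
Definition letter_val s (l : 'I_n * bool) : G :=
  if l.2 then (s l.1)^-1 else s l.1.

Definition word_val s w : G := \prod_(l <- w) letter_val s l.

Definition generates s : Prop := forall g : G, exists w, word_val s w = g.

Definition i_positive (i : 'I_n) w : bool :=
  [&& (i, false) \in w, all (fun l : 'I_n * bool => (i <= l.1)%N) w & (i, true) \notin w].

Definition sigma_positive s : set G :=
  [set g | exists i w, i_positive i w /\ word_val s w = g].

Definition defines_Dehornoy_like s : Prop :=
  cone_of_left_ordering (sigma_positive s).

(* The exponent (-1)^(n - i + 1) for 1-based i is (-1)^(n - i) for 0-based i. *)
Definition twisted s (i : 'I_n) : G :=
  let x := \prod_(j < n | (i <= j)%N) s j in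
  if odd (n - i) then x^-1 else x.

Definition tail_set a (k : nat) : set G := a @` [set j : 'I_n | (k <= j)%N].

Definition property_F s : Prop :=
  let a := twisted s in
  let P k := word_positive (tail_set a k) in
  forall i : 'I_n, (i.+1 < n)%N ->
    [set a i * g^-1 * (a i)^-1 | g in P i.+1] `<=` P i /\
    [set (a i)^-1 * g^-1 * a i | g in P i.+1] `<=` P i.

End OrderedGeneratingSets.

(* Main.v *)
Require Import Defs.
From mathcomp Require Import all_boot.
From mathcomp Require Import all_classical topology.

Set Implicit Arguments.
Unset Strict Implicit.
Unset Printing Implicit Defensive.

Local Open Scope classical_set_scope.
Local Open Scope group_scope.

(** Let a be the twisted family of s. For each k let K_k be the subgroup
    generated by the a_j with j >= k, and P_k the semigroup generated by these
    same a_j. With x_i = s_i s_(i+1) ... we have a_i = x_i^(+-1) and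
    s_i = x_i x_(i+1)^-1, so s and a generate the same subgroups K_k, and the
    double coset of s_i over K_(i+1) is that of a_i or of its inverse.
    Call an element i-positive for a family t if it lies in the semigroup
    generated by K_(i+1) t_i K_(i+1). Up to inversion, with a sign that depends
    only on i, the i-positive elements for s are those for a
    ([index_positive_twisted]), and the sigma-positive elements are those that
    are i-positive for s for some i ([sigma_positiveP]).

    Both directions of the theorem pass through the trichotomy
    K_k = P_k u {1} u P_k^-1 for all k. If it holds at i + 1, then Property F
    moves the negative elements of K_(i+1) across a_i and shows that every
    element i-positive for a lies in P_i ([index_positive_word]). Conversely,
    an element of P_k is i-positive for a, where i is the least index used
    ([word_positive_index]).

    If the sigma-positive elements form a positive cone, the trichotomy follows
    by descending induction on k: an element of K_k cannot be j-positive with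
    j < k, because then 1 would be j-positive. So P_0 is a positive cone, and a
    positive cone generated by finitely many elements is isolated: any ordering
    close to it makes these generators positive
    ([isolated_ordering_fin_gen]).

    If P_0 is the positive cone of an ordering, the trichotomy at 0 is given,
    but it is not inherited by P_i at once: a positive word that uses some a_j
    with j < i might represent an element of K_i. Property F gives P_i < a_j
    for j < i, so this is excluded once every element of K_i is bounded above
    by some element of P_i ([tail_group_bounded], [trichotomous_step]). This
    boundedness is proved by descending induction on i, and its core is that
    a_i P_i is cofinal in P_i ([cofinal_gen]). To see this, look at the orbit
    K_(i+1) a_i, which lies in P_i by Property F. Either left multiplication
    by a_i keeps the orbit below itself; then the whole of P_i lies below the
    orbit, and a_i^-1 sends the orbit below P_i. Or some m = a_i x a_i, with x
    in K_(i+1), is an upper bound of the orbit; then no positive element can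
    push the orbit down past itself, this forces every product of r generators
    of P_i to be at most m^r, and m^r is in a_i P_i. *)

(** * Semigroups and subgroups generated by a set *)

Section Monoids.
Variable G : groupType.
Implicit Types (A B K : set G) (g h x k : G).

Lemma word_positive_gen A x : A x -> word_positive A x.
Proof.
move=> Ax; exists [:: x]; split=> //; last by rewrite big_seq1.
by move=> y; rewrite inE => /eqP->.
Qed.

Lemma word_positiveM A g h :
  word_positive A g -> word_positive A h -> word_positive A (g * h).
Proof.
move=> [v [v0 Av ->]] [w [w0 Aw ->]]; exists (v ++ w); split.
- by case: v v0 {Av}.
- by move=> x; rewrite mem_cat => /orP[/Av|/Aw].
- by rewrite big_cat.
Qed.

Lemma word_positive_ind A (Q : G -> Prop) :
    (forall x, A x -> Q x) ->
    (forall x g, A x -> word_positive A g -> Q g -> Q (x * g)) ->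
  forall g, word_positive A g -> Q g.
Proof.
move=> Q1 QM g [w [w0 Aw ->]] {g}; elim: w w0 Aw => // x [|y w] IHw _ Aw.
  by rewrite big_seq1; apply: Q1; apply: Aw; rewrite inE.
have Ayw z : z \in y :: w -> A z by move=> zw; apply: Aw; rewrite inE zw orbT.
rewrite big_cons; apply: QM; [by apply: Aw; rewrite inE eqxx| |exact: IHw].
by exists (y :: w).
Qed.

Lemma word_positiveX A g h r :
  word_positive A g -> word_positive A h -> word_positive A (g * h ^+ r).
Proof.
move=> Ag Ah; elim: r => [|r IHr]; first by rewrite expg0 mulg1.
by rewrite expgSr mulgA; apply: word_positiveM.
Qed.

Lemma word_positive_sub A B :
  A `<=` word_positive B -> word_positive A `<=` word_positive B.
Proof.
move=> AB; apply: word_positive_ind => [x /AB //|x g /AB Bx _ Bg].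
exact: word_positiveM.
Qed.

Definition is_subgroup K : Prop :=
  [/\ K 1, forall g h, K g -> K h -> K (g * h) & forall g, K g -> K g^-1].

(** Words are extended on the left only, so that induction follows the letters
    of a word. *)
Inductive span A : set G :=
| span1 : span A 1
| span_cons x g : A x -> span A g -> span A (x * g)
| span_consV x g : A x -> span A g -> span A (x^-1 * g).

Lemma span_subgroup A : is_subgroup (span A).
Proof.
have M g h : span A g -> span A h -> span A (g * h).
  move=> Ag Ah; elim: Ag => {g} [|x g Ax _ IH|x g Ax _ IH].
  - by rewrite mul1g.
  - by rewrite -mulgA; apply: span_cons.
  - by rewrite -mulgA; apply: span_consV.
split=> // [|g]; first exact: span1.
elim=> {g} [|x g Ax _ IH|x g Ax _ IH]; rewrite ?invg1 ?invgM ?invgK.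
- exact: span1.
- apply: M => //; rewrite -[x^-1]mulg1.
  by apply: span_consV => //; apply: span1.
- apply: M => //; rewrite -[x]mulg1.
  by apply: span_cons => //; apply: span1.
Qed.

Lemma span_gen A x : A x -> span A x.
Proof.
by move=> Ax; rewrite -[x]mulg1; apply: span_cons => //; apply: span1.
Qed.

Lemma span_sub A K : is_subgroup K -> A `<=` K -> span A `<=` K.
Proof.
move=> [K1 KM KV] AK g; elim=> {g} // x g /AK Kx _ Kg; apply: KM => //.
exact: KV.
Qed.

Lemma word_positive_span A : word_positive A `<=` span A.
Proof.
have [_ M _] := span_subgroup A.
apply: word_positive_ind => [x /span_gen//|x g /span_gen Ax _ Ag].
exact: M.
Qed.

(** For a subgroup K, these are the elements that can be written with letters
    x and elements of K, with x used at least once and x^-1 not at all. *)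
Definition positive_over K x : set G :=
  word_positive [set g | exists k k', [/\ K k, K k' & g = k * x * k']].

Lemma positive_over_gen K x k k' :
  K k -> K k' -> positive_over K x (k * x * k').
Proof. by move=> Kk Kk'; apply: word_positive_gen; exists k, k'. Qed.

Lemma positive_overMl K x k g : is_subgroup K ->
  K k -> positive_over K x g -> positive_over K x (k * g).
Proof.
move=> [_ KM _] Kk; elim/word_positive_ind => {g}.
  move=> _ [k1 [k2 [K1 K2 ->]]]; rewrite !mulgA.
  by apply: positive_over_gen => //; apply: KM.
move=> _ g [k1 [k2 [K1 K2 ->]]] xg _; rewrite !mulgA.
by apply: word_positiveM => //; apply: positive_over_gen => //; apply: KM.
Qed.

Lemma positive_overMr K x k g : is_subgroup K ->
  K k -> positive_over K x g -> positive_over K x (g * k).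
Proof.
move=> [_ KM _] Kk; elim/word_positive_ind => {g}.
  move=> _ [k1 [k2 [K1 K2 ->]]]; rewrite -!mulgA mulgA.
  by apply: positive_over_gen => //; apply: KM.
move=> _ g [k1 [k2 [K1 K2 ->]]] xg IH; rewrite -mulgA.
by apply: word_positiveM => //; apply: positive_over_gen.
Qed.

(** Only the double coset K x K matters: this is what allows one to replace
    s_i by the product s_i s_(i+1) ... *)
Lemma positive_over_coset K x k : is_subgroup K -> K k ->
  positive_over K (x * k) = positive_over K x.
Proof.
move=> [K1 KM KV] Kk; apply/seteqP; split; apply: word_positive_sub.
  move=> _ [k1 [k2 [Kk1 Kk2 ->]]]; rewrite -!mulgA mulgA.
  by apply: positive_over_gen => //; apply: KM.
move=> _ [k1 [k2 [Kk1 Kk2 ->]]].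
have -> : k1 * x * k2 = k1 * (x * k) * (k^-1 * k2) by rewrite !mulgA mulgK.
by apply: positive_over_gen => //; apply: KM => //; apply: KV.
Qed.

Lemma positive_overV K x g : is_subgroup K ->
  positive_over K x^-1 g -> positive_over K x g^-1.
Proof.
move=> [_ _ KV]; elim/word_positive_ind => {g} [_ [k1 [k2 [Kk1 Kk2 ->]]]|].
  rewrite !invgM invgK mulgA.
  by apply: positive_over_gen; apply: KV.
move=> _ g [k1 [k2 [Kk1 Kk2 ->]]] _ IH.
rewrite invgM; apply: word_positiveM => //; rewrite !invgM invgK mulgA.
by apply: positive_over_gen; apply: KV.
Qed.

Lemma positive_overVE K x g : is_subgroup K ->
  positive_over K x^-1 g <-> positive_over K x g^-1.
Proof.
move=> sK; split; first exact: positive_overV.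
by rewrite -{1}[x]invgK => /(positive_overV sK); rewrite invgK.
Qed.

Lemma positive_over_span K x B :
  is_subgroup B -> K `<=` B -> B x -> positive_over K x `<=` B.
Proof.
move=> [_ BM _] KB Bx; apply: word_positive_ind.
  by move=> _ [k [k' [/KB Bk /KB Bk' ->]]]; do 2!apply: (BM) => //.
by move=> _ g [k [k' [/KB Bk /KB Bk' ->]]] _ Bg; do 3!apply: (BM) => //.
Qed.

End Monoids.

(** * Positive cones and isolated orderings *)

Section LeftOrders.
Variable G : groupType.
Implicit Types (P Q A : set G) (lt : rel G) (g h : G).

Lemma cone_of_left_orderingP P :
  cone_of_left_ordering P <->
  [/\ forall g h, P g -> P h -> P (g * h),
      forall g, [\/ P g, g = 1 | P g^-1] & ~ P 1].
Proof.
split=> [[lt [irr tr tot inv] ->]|[PM Ptot P1]].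
  split; rewrite /positive_cone /=; last by rewrite irr.
    by move=> g h g1 /(inv g); rewrite mulg1; apply: tr.
  move=> g; have [->|g1] := eqVneq g 1; first by constructor 2.
  have /orP[g_lt1|] := tot _ _ g1; last by constructor 1.
  by constructor 3; rewrite -(mulVg g) -[X in lt _ X]mulg1; apply: inv.
exists (fun g h => `[< P (g^-1 * h) >]); last first.
  apply/seteqP; split=> g; rewrite /positive_cone /= invg1 mul1g;
    [by move=> Pg; apply/asboolP | by move/asboolP].
split.
- by move=> g; apply/asboolP; rewrite mulVg.
- move=> h g k /asboolP gh /asboolP hk; apply/asboolP.
  by rewrite -(mulVKg h k) mulgA; apply: PM.
- move=> g h gh; apply/orP; have [Pg|e|Pg] := Ptot (g^-1 * h).
  + by left; apply/asboolP.
  + by move: gh; rewrite -(mulVKg g h) e mulg1 eqxx.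
  + by right; apply/asboolP; rewrite invgM invgK in Pg.
- move=> k g h /asboolP gh; apply/asboolP.
  by rewrite invgM -mulgA mulKg.
Qed.

Lemma positive_coneP lt : left_ordering lt ->
  [/\ forall g h, lt 1 g -> lt 1 h -> lt 1 (g * h),
      forall g, [\/ lt 1 g, g = 1 | lt 1 g^-1] & ~ lt 1 1].
Proof.
by move=> ltP; apply/(cone_of_left_orderingP (positive_cone lt)); exists lt.
Qed.

(** A positive cone is maximal: a larger one would contain some g together
    with its inverse. *)
Lemma positive_cone_sub_eq lt lt' : left_ordering lt -> left_ordering lt' ->
  positive_cone lt `<=` positive_cone lt' -> lt 1 =1 lt' 1.
Proof.
move=> l l' sub g; apply/idP/idP; first exact: sub.
have [_ tot _] := positive_coneP l; have [M' _ no1] := positive_coneP l'.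
move=> g1; have [//|g0|/sub gV] := tot g.
  by case: no1; rewrite -{2}g0.
by case: no1; rewrite -{2}(mulgV g); apply: M'.
Qed.

(** The neighbourhood that requires all generators to be positive is open
    because there are finitely many of them; an ordering in it has a larger
    cone, hence the same one. *)
Lemma isolated_ordering_fin_gen (I : finType) (a : I -> G) lt :
  left_ordering lt -> word_positive (range a) = positive_cone lt ->
  isolated_ordering lt.
Proof.
move=> ltP cone_lt; split=> //.
have a1 i : lt 1 (a i).
  have : word_positive (range a) (a i) by apply: word_positive_gen; exists i.
  by rewrite cone_lt.
have a_neq1 i : a i != 1.
  by apply: contraL (a1 i) => /eqP->; have [->] := ltP.
split; first by rewrite inE; exists lt.
have near_a i : nbhs (cone_point lt : cone_space G)
    [set p : cone_space G | p (Sub (a i) (a_neq1 i))].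
  pose j : {g : G | g != 1} := Sub (a i) (a_neq1 i).
  apply: (@proj_continuous {g : G | g != 1} (fun=> bool) j (cone_point lt)
    [set b : bool | b]).
  by rewrite nbhs_principalE; apply/principal_filterP; apply: a1.
exists [set p : cone_space G | forall i, p (Sub (a i) (a_neq1 i))].
  exact: (filter_forall (nbhs_filter _) near_a).
apply/seteqP; split=> [p [/= + [lt' lt'P e]]|_ ->].
  rewrite -{}e {p} => pos.
  apply/funext => -[g g1]; rewrite /cone_point /=; apply/esym.
  apply: positive_cone_sub_eq => //; rewrite -cone_lt.
  have [M' _ _] := positive_coneP lt'P.
  apply: word_positive_ind => [_ [i _ <-]|_ h [i _ <-] _]; first exact: pos i.
  by apply: M'; apply: pos i.
by split; [exact: a1 | exists lt].
Qed.

End LeftOrders.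

(** * Positivity relative to an ordered family *)

Section Tails.
Variables (G : groupType) (n : nat).
Implicit Types (t : 'I_n -> G) (g h : G) (k : nat) (i j : 'I_n).

Definition tail_group t k : set G := span (tail_set t k).

(** Word-free form of being represented by an i-positive word. *)
Definition index_positive t i : set G :=
  positive_over (tail_group t i.+1) (t i).

Lemma tail_group_subgroup t k : is_subgroup (tail_group t k).
Proof. exact: span_subgroup. Qed.
Local Hint Resolve tail_group_subgroup : core.

Lemma tail_group_gen t k i : (k <= i)%N -> tail_group t k (t i).
Proof. by move=> ki; apply: span_gen; exists i. Qed.

Lemma tail_group_sub t k k' :
  (k <= k')%N -> tail_group t k' `<=` tail_group t k.
Proof.
move=> kk'; apply: span_sub => // _ [i /= k'i <-].
by apply: tail_group_gen; apply: leq_trans k'i.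
Qed.

Lemma tail_group_trivial t k g : (n <= k)%N -> tail_group t k g -> g = 1.
Proof.
move=> nk; elim=> {g} // x g [i /= ki _].
  by have := leq_trans (ltn_ord i) (leq_trans nk ki); rewrite ltnn.
by have := leq_trans (ltn_ord i) (leq_trans nk ki); rewrite ltnn.
Qed.

Lemma index_positive_tail t i k :
  (k <= i)%N -> index_positive t i `<=` tail_group t k.
Proof.
move=> ki; apply: positive_over_span => //; last exact: tail_group_gen.
by apply: tail_group_sub; apply: leqW.
Qed.

Lemma index_positive_gen t i : index_positive t i (t i).
Proof.
rewrite /index_positive -{2}[t i]mulg1 -{2}[t i]mul1g.
by apply: positive_over_gen; apply: span1.
Qed.

(** The smaller index wins, since the other factor lies in the subgroup over
    which positivity is taken. *)
Lemma index_positiveM t i j g h :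
  index_positive t i g -> index_positive t j h ->
  exists l : 'I_n, l = minn i j :> nat /\ index_positive t l (g * h).
Proof.
move=> gi hj; case: (ltngtP i j) => ij.
- exists i; split => //; apply: positive_overMr => //.
  exact: index_positive_tail hj.
- exists j; split => //; apply: positive_overMl => //.
  exact: index_positive_tail gi.
- exists i; split => //; apply: word_positiveM => //.
  by have -> : i = j by apply: val_inj.
Qed.

Lemma word_positive_index t k g : word_positive (tail_set t k) g ->
  exists2 i : 'I_n, (k <= i)%N & index_positive t i g.
Proof.
elim/word_positive_ind => {g} [_ [i /= ki <-]|_ g [i /= ki <-] _ [j kj gj]].
  by exists i => //; apply: index_positive_gen.
have [l [lE lP]] := index_positiveM (index_positive_gen t i) gj.
by exists l => //; rewrite lE leq_min ki.
Qed.

Lemma word_val_cat t v w : word_val t (v ++ w) = word_val t v * word_val t w.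
Proof. exact: big_cat. Qed.

Lemma tail_group_word t k g : tail_group t k g ->
  exists2 w, all (fun l : 'I_n * bool => (k <= l.1)%N) w & word_val t w = g.
Proof.
elim=> {g} [|_ g [i /= ki <-] _ [w kw <-]|_ g [i /= ki <-] _ [w kw <-]].
- by exists [::] => //; rewrite /word_val big_nil.
- by exists ((i, false) :: w); rewrite /= ?ki // /word_val big_cons.
- by exists ((i, true) :: w); rewrite /= ?ki // /word_val big_cons.
Qed.

Lemma sigma_positiveP t g :
  sigma_positive t g <-> exists i, index_positive t i g.
Proof.
split=> [[i [w [/and3P[iw ki niw] <-]]]|[i]].
  (* Before the letter s_i has been met, a suffix of w only uses letters of
     index larger than i and is an element of the subgroup. *)
  exists i; suff : if (i, false) \in w then index_positive t i (word_val t w)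
    else tail_group t i.+1 (word_val t w) by rewrite iw.
  elim: w ki niw {iw} => [_ _|[j b] w IHw /= /andP[ij kw]].
    by rewrite in_nil /word_val big_nil; apply: span1.
  rewrite !inE negb_or => /andP[nij /(IHw kw)] {IHw}.
  rewrite /word_val big_cons -/(word_val t w) /letter_val /=.
  have [M1 M2 M3] := tail_group_subgroup t i.+1.
  have [ji|ji] := eqVneq i j.
    subst j; case: b nij => /=; first by rewrite eqxx.
    rewrite xpair_eqE !eqxx /= => _; case: ifP => _ w_i.
      by apply: word_positiveM => //; apply: index_positive_gen.
    by apply: positive_overMr => //; apply: index_positive_gen.
  rewrite xpair_eqE (negbTE ji) /=.
  have lj : tail_group t i.+1 (if b then (t j)^-1 else t j).
    have jK : tail_group t i.+1 (t j).
      by apply: tail_group_gen; rewrite ltn_neqAle ij andbT.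
    by case: b {nij} => //; apply: M3.
  by case: ifP => _ w_i; [apply: positive_overMl | apply: M2].
(* Conversely, each factor x s_i y is spelled by a word with one letter s_i. *)
suff word_of h : index_positive t i h ->
    exists w, i_positive i w /\ word_val t w = h.
  by move=> /word_of[w wP]; exists i, w.
have syll x y : tail_group t i.+1 x -> tail_group t i.+1 y ->
    exists w, i_positive i w /\ word_val t w = x * t i * y.
  move=> /tail_group_word[u iu <-] /tail_group_word[v iv <-].
  exists (u ++ (i, false) :: v); split; last first.
    by rewrite word_val_cat /word_val big_cons mulgA.
  have nin b w : all (fun l : 'I_n * bool => (i < l.1)%N) w -> (i, b) \notin w.
    by move=> /allP iw; apply/negP => /iw; rewrite /= ltnn.
  have ge w : all (fun l : 'I_n * bool => (i < l.1)%N) w ->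
      all (fun l : 'I_n * bool => (i <= l.1)%N) w.
    by apply: sub_all => l; apply: ltnW.
  rewrite /i_positive !mem_cat !inE eqxx orbT all_cat /= leqnn !ge //=.
  by rewrite negb_or nin //= xpair_eqE andbF nin.
elim/word_positive_ind => [_ [x [y [? ? ->]]]|]; first exact: syll.
move=> _ h' [x [y [Kx Ky ->]]] _ [w [/and3P[iw kw nw] <-]].
have [u [/and3P[iu ku nu] <-]] := syll _ _ Kx Ky.
exists (u ++ w); split; last exact: word_val_cat.
by rewrite /i_positive !mem_cat iu all_cat ku kw /= negb_or nu.
Qed.

Lemma generates_tail_group t g : generates t -> tail_group t 0 g.
Proof.
move=> /(_ g)[w <-]; elim: w => [|[j b] w IHw].
  by rewrite /word_val big_nil; apply: span1.
rewrite /word_val big_cons -/(word_val t w) /letter_val /=.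
by case: b; [apply: span_consV | apply: span_cons] => //; exists j.
Qed.

Definition tail_prod t k : G := \prod_(j < n | (k <= j)%N) t j.

Lemma tail_prod_nil t k : (n <= k)%N -> tail_prod t k = 1.
Proof.
move=> nk; rewrite /tail_prod big_pred0 // => j.
by apply/negbTE; rewrite -ltnNge; apply: leq_trans nk.
Qed.

(** The product ranges over a filtered enumeration and the group need not be
    commutative, so the first factor is split off by comparing lists of
    indices. *)
Lemma tail_prod_cons t i : tail_prod t i = t i * tail_prod t i.+1.
Proof.
have tailE k : (k <= n)%N ->
    map val [seq j : 'I_n <- enum 'I_n | (k <= j)%N] = iota k (n - k).
  move=> kn; rewrite -(filter_map val (leq k)) val_enum_ord.
  rewrite -{1}(subnKC kn) iotaD filter_cat.
  rewrite (@eq_in_filter _ _ pred0); last first.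
    by move=> j; rewrite mem_iota add0n leq0n /= ltnNge => /negbTE.
  rewrite filter_pred0 cat0s add0n; apply/all_filterP/allP => j.
  by rewrite mem_iota => /andP[].
have prodE k : tail_prod t k =
    \prod_(j <- [seq j : 'I_n <- enum 'I_n | (k <= j)%N]) t j.
  by rewrite big_filter enumT /tail_prod [index_enum _]unlock.
rewrite !prodE.
suff -> : [seq j : 'I_n <- enum 'I_n | (i <= j)%N] =
    i :: [seq j : 'I_n <- enum 'I_n | (i < j)%N] by rewrite big_cons.
apply: (inj_map val_inj); rewrite /= !tailE //; last exact: ltnW.
by rewrite -subnSK.
Qed.

Lemma twistedE t i : twisted t i =
  if odd (n - i) then (tail_prod t i)^-1 else tail_prod t i.
Proof. by []. Qed.

Lemma tail_prod_group t k : tail_group t k (tail_prod t k).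
Proof.
have [M1 M2 M3] := tail_group_subgroup t k.
rewrite /tail_prod; elim/big_ind: _ => // j; exact: tail_group_gen.
Qed.

Lemma twisted_tail_prod t k : tail_group (twisted t) k (tail_prod t k).
Proof.
have [M1 M2 M3] := tail_group_subgroup (twisted t) k.
have [nk|kn] := leqP n k; first by rewrite tail_prod_nil.
have := @tail_group_gen (twisted t) k (Ordinal kn) (leqnn _).
by rewrite twistedE; case: ifP => //= _ /M3; rewrite invgK.
Qed.

(** Each t_i is the quotient of two consecutive tail products, and these are
    the twisted elements up to inversion. *)
Lemma tail_group_twisted t k : tail_group (twisted t) k = tail_group t k.
Proof.
apply/seteqP; split; apply: span_sub => // _ [i /= ki <-].
  have [_ _ M3] := tail_group_subgroup t i.
  apply: (tail_group_sub ki); rewrite twistedE.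
  by case: ifP => _; [apply: M3|]; apply: tail_prod_group.
have [_ M2 M3] := tail_group_subgroup (twisted t) i.
apply: (tail_group_sub ki).
have -> : t i = tail_prod t i * (tail_prod t i.+1)^-1.
  by rewrite tail_prod_cons mulgK.
apply: M2; first exact: twisted_tail_prod.
by apply: M3; apply: (tail_group_sub (leqnSn i)); apply: twisted_tail_prod.
Qed.

(** The tail product x_i lies in t_i K, for K the subgroup of larger indices,
    and x_i^-1 replaces it when n - i is odd. *)
Lemma index_positive_twisted t i g : index_positive (twisted t) i g <->
  index_positive t i (if odd (n - i) then g^-1 else g).
Proof.
rewrite /index_positive tail_group_twisted twistedE.
rewrite -(@positive_over_coset _ _ (t i) _ (tail_group_subgroup _ _)
  (tail_prod_group t i.+1)) -tail_prod_cons.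
by case: ifP => _ //; apply: positive_overVE.
Qed.

End Tails.

(** * Trichotomy for the tail subgroups *)

Section Trichotomy.
Variables (G : groupType) (n : nat) (a : 'I_n -> G).
Implicit Types (g h x y : G).

Definition trichotomous k : Prop := forall g, tail_group a k g ->
  [\/ word_positive (tail_set a k) g, g = 1
    | word_positive (tail_set a k) g^-1].

(** Property F at the index i. At the last index the tail is empty and the
    condition is void. *)
Definition reverses_tail (i : 'I_n) : Prop :=
  forall g, word_positive (tail_set a i.+1) g ->
    word_positive (tail_set a i) (a i * g^-1 * (a i)^-1) /\
    word_positive (tail_set a i) ((a i)^-1 * g^-1 * a i).

Lemma tail_set_sub k k' : (k <= k')%N ->
  word_positive (tail_set a k') `<=` word_positive (tail_set a k).
Proof.
move=> kk'; apply: word_positive_sub => _ [i /= k'i <-].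
by apply: word_positive_gen; exists i => //=; apply: leq_trans k'i.
Qed.

Lemma word_positive_tail_group k :
  word_positive (tail_set a k) `<=` tail_group a k.
Proof. exact: word_positive_span. Qed.

Section Step.
Variable i : 'I_n.
Hypotheses (rev_i : reverses_tail i) (tri_i : trichotomous i.+1).

Let P := word_positive (tail_set a i).
Let K := tail_group a i.+1.

Let subK : is_subgroup K. Proof. exact: tail_group_subgroup. Qed.

Let Pa : P (a i).
Proof. by apply: word_positive_gen; exists i => /=. Qed.

Let PM g h : P g -> P h -> P (g * h). Proof. exact: word_positiveM. Qed.

Let sub_tail g : word_positive (tail_set a i.+1) g -> P g.
Proof. by apply: tail_set_sub; apply: leqnSn. Qed.

Let gen_cases x :
  tail_set a i x -> x = a i \/ word_positive (tail_set a i.+1) x.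
Proof.
move=> [j /= ij <-]; have [ji|ji] := eqVneq i j; first by left; rewrite ji.
right; apply: word_positive_gen; exists j => //=.
by rewrite ltn_neqAle ij andbT.
Qed.

(** A negative x is moved across a_i: x a_i = a_i (a_i^-1 x a_i), and the
    conjugate is positive. *)
Lemma subgroup_mul_gen x : K x -> P (x * a i).
Proof.
case/tri_i => [/sub_tail Px|->|/rev_i[_]]; [exact: PM|by rewrite mul1g|].
by rewrite invgK => /(PM Pa); rewrite !mulgA mulgV mul1g.
Qed.

Lemma gen_mul_subgroup x : K x -> P (a i * x).
Proof.
case/tri_i => [/sub_tail Px|->|/rev_i[+ _]]; [exact: PM|by rewrite mulg1|].
by rewrite invgK => /PM /(_ Pa); rewrite mulgVK.
Qed.

(** After the last letter a_i of p one has an element of K, which absorbs x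
    before that letter absorbs the result. *)
Lemma positive_mul_subgroup p : P p -> K p \/ forall x, K x -> P (p * x).
Proof.
have [_ KM _] := subK.
elim/word_positive_ind => {p} [x /gen_cases[->|/word_positive_tail_group Kx]|].
- by right; apply: gen_mul_subgroup.
- by left.
move=> x p /gen_cases[-> _ IH|xP _ [Kp|IH]].
- right=> y Ky; rewrite -mulgA; case: IH => [Kp|/(_ _ Ky)]; last exact: PM.
  by apply: gen_mul_subgroup; apply: KM.
- by left; apply: KM => //; apply: word_positive_tail_group.
- by right=> y Ky; rewrite -mulgA; apply: PM; [apply: sub_tail | apply: IH].
Qed.

(** In a factor x a_i y, the letter a_i can absorb one negative neighbour. If
    both are negative, x is moved across a_i and becomes a positive p; then y
    is absorbed either by a letter a_i of p or, when p is in K, by the a_i on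
    the left of p. *)
Lemma index_positive_word : index_positive a i `<=` P.
Proof.
have [_ KM _] := subK.
apply: word_positive_sub => _ [x [y [Kx Ky ->]]].
case: (tri_i Kx) => [/sub_tail Px|->|/rev_i[_]].
- by rewrite -mulgA; apply: PM => //; apply: gen_mul_subgroup.
- by rewrite mul1g; apply: gen_mul_subgroup.
rewrite invgK => Pp.
have -> : x * a i * y = a i * ((a i)^-1 * x * a i * y).
  by rewrite !mulgA mulgV mul1g.
have [Kp|Pr] := positive_mul_subgroup Pp; last by apply: PM => //; apply: Pr.
by apply: gen_mul_subgroup; apply: KM.
Qed.

Lemma positive_cases p : P p -> K p \/ index_positive a i p.
Proof.
have [_ KM _] := subK.
elim/word_positive_ind => {p} [x /gen_cases[->|/word_positive_tail_group Kx]|].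
- by right; apply: index_positive_gen.
- by left.
move=> x p /gen_cases[-> _ [Kp|ip]|/word_positive_tail_group Kx _ [Kp|ip]].
- by right; apply: positive_overMr => //; apply: index_positive_gen.
- by right; apply: word_positiveM => //; apply: index_positive_gen.
- by left; apply: KM.
- by right; apply: positive_overMl.
Qed.

(** From here on, the whole family generates a positive cone as a semigroup,
    and smaller indices also satisfy Property F. *)
Variable lt : rel G.
Hypotheses (ltP : left_ordering lt)
  (cone_lt : word_positive (tail_set a 0) = positive_cone lt)
  (rev_lt : forall j : 'I_n, (j < i)%N -> reverses_tail j).

Let le g h := ~~ lt h g.

Let lt_inv2l x g h : lt (x * g) (x * h) = lt g h.
Proof.
have [_ _ _ inv] := ltP; apply/idP/idP => [/(inv x^-1)|/inv//].
by rewrite !mulKg.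
Qed.

Let le_inv2l x g h : le (x * g) (x * h) = le g h.
Proof. by rewrite /le lt_inv2l. Qed.

Let ltW g h : lt g h -> le g h.
Proof.
have [irr tr _ _] := ltP; move=> gh; apply/negP => /(tr _ _ _ gh).
by rewrite irr.
Qed.

Let le_total g h : le g h \/ lt h g.
Proof. by rewrite /le; case: (lt h g); [right|left]. Qed.

Let lexx g : le g g.
Proof. by have [irr _ _ _] := ltP; rewrite /le irr. Qed.

Let le_eqVlt g h : le g h -> g = h \/ lt g h.
Proof.
have [_ _ tot _] := ltP.
rewrite /le; have [->|/tot] := eqVneq g h; first by left.
by case/orP => [|->]; [right|].
Qed.

Let le_trans h g k : le g h -> le h k -> le g k.
Proof.
have [_ tr _ _] := ltP.
by move=> /le_eqVlt[->//|gh] /le_eqVlt[<-|/(tr _ _ _ gh)]; apply: ltW.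
Qed.

Let lt_le_trans h g k : lt g h -> le h k -> lt g k.
Proof. by have [_ tr _ _] := ltP; move=> gh /le_eqVlt[<-|/(tr _ _ _ gh)]. Qed.

Let pos_gt1 k g : word_positive (tail_set a k) g -> lt 1 g.
Proof.
move=> /(tail_set_sub (leq0n k)); rewrite cone_lt; exact.
Qed.

Let lt_subgroup_gen x : K x -> lt x (a i).
Proof.
have [_ _ KV] := subK.
move=> /KV /subgroup_mul_gen /pos_gt1.
by rewrite -(lt_inv2l x) mulVKg mulg1.
Qed.

(** The conjugate a_j^-1 g^-1 a_j is positive, so a_j < g^-1 a_j; the first is
    larger than 1. *)
Let lt_positive_gen (j : 'I_n) g : (j < i)%N -> P g -> lt g (a j).
Proof.
move=> ji Pg; have [|_] := @rev_lt j ji g; first exact: tail_set_sub Pg.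
move=> /pos_gt1; rewrite -(lt_inv2l (a j)) mulg1 -mulgA mulVKg => h.
rewrite -(lt_inv2l g^-1) mulVg; apply: lt_le_trans (ltW h).
by apply: (@pos_gt1 0); apply: word_positive_gen; exists j.
Qed.

(** According to the sign of x in K, the conjugate of x by a_i is negative,
    trivial or in P. *)
Let orbit_pull x : K x -> exists2 m, P m & le ((a i)^-1 * (x * a i)) m.
Proof.
case/tri_i => [/rev_i[_ /pos_gt1 lt1]|->|/rev_i[_ Pm]].
- exists (a i) => //; apply: ltW; apply: lt_le_trans (ltW (pos_gt1 Pa)).
  rewrite -(lt_inv2l ((a i)^-1 * x^-1 * a i)) mulg1.
  by rewrite -!mulgA mulVKg mulKg mulVg mulgA.
- by exists (a i) => //; rewrite mul1g mulVg; apply: ltW; apply: pos_gt1 Pa.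
- by exists ((a i)^-1 * x * a i); rewrite ?mulgA // -{1}[x]invgK.
Qed.

(** Both K and a_i keep the orbit K a_i below itself, so all of P lies below
    that orbit, and the orbit is sent below P by a_i^-1. *)
Let cofinal_absorbed m' :
    (forall x, K x -> exists2 y, K y & lt (a i * x * a i) (y * a i)) ->
  P m' -> exists2 m, P m & le m' (a i * m).
Proof.
have [K1 KM _] := subK.
move=> absorb Pm'.
have orbit : forall x, K x -> exists2 y, K y & le (m' * x * a i) (y * a i).
  elim/word_positive_ind: Pm'
    => {m'} [g /gen_cases[->|/word_positive_tail_group Kg] x Kx|].
  - by have [y Ky /ltW] := absorb x Kx; exists y.
  - by exists (g * x); [apply: KM | apply: lexx].
  move=> g m' /gen_cases[->|/word_positive_tail_group Kg] _ IH x /IH[y Ky ley].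
    have [z Kz ltz] := absorb y Ky; exists z => //.
    by apply: le_trans (ltW ltz); rewrite -!mulgA le_inv2l mulgA.
  exists (g * y); first exact: KM.
  by rewrite -!mulgA le_inv2l mulgA.
have [y Ky ley] := orbit 1 K1; have [m Pm ym] := orbit_pull Ky; exists m => //.
apply: (@le_trans (m' * 1 * a i)).
  by rewrite mulg1 -{1}[m']mulg1 le_inv2l; apply: ltW; apply: pos_gt1 Pa.
apply: le_trans ley _.
by rewrite -(mulVKg (a i) (y * a i)) le_inv2l.
Qed.

(** Here m0 = a_i x0 a_i bounds the orbit K a_i from above. The supremum of
    the orbit can then only be moved up by positive elements, and products of
    generators grow no faster than the powers of m0. *)
Let cofinal_escaping m' x0 : K x0 ->
    (forall x, K x -> le (x * a i) (a i * x0 * a i)) ->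
  P m' -> exists2 m, P m & le m' (a i * m).
Proof.
have [K1 KM KV] := subK.
move=> Kx0 escape Pm'; set m0 := a i * x0 * a i in escape.
have Pm0 : P m0 by rewrite /m0 -mulgA; apply: PM => //; apply: subgroup_mul_gen.
(* Positive elements do not move the supremum of the orbit down. *)
have shift1 q : word_positive (tail_set a 0) q ->
    forall x, K x -> exists2 y, K y & le (x * a i) (q * (y * a i)).
  have gen q' : tail_set a 0 q' ->
      forall x, K x -> exists2 y, K y & le (x * a i) (q' * (y * a i)).
    move=> [j _ <-] x Kx; case: (ltngtP j i) => ji.
    - exists 1 => //; rewrite mul1g; apply: ltW.
      apply: lt_le_trans (lt_positive_gen ji (subgroup_mul_gen Kx)) _.
      by rewrite -{1}[a j]mulg1 le_inv2l; apply: ltW; apply: pos_gt1 Pa.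
    - have Kj : K (a j) by apply: tail_group_gen.
      exists ((a j)^-1 * x); first by apply: KM => //; apply: KV.
      by rewrite -!mulgA mulVKg; apply: lexx.
    - have -> : j = i by apply: val_inj.
      by exists x0 => //; rewrite mulgA; apply: escape.
  elim/word_positive_ind => [//|q' q0 /gen{}gen _ IH x /gen[y /IH[z Kz yz] xy]].
  exists z => //; apply: le_trans xy _; rewrite -mulgA.
  by rewrite le_inv2l.
have shift q x : le 1 q -> K x -> exists2 y, K y & le (x * a i) (q * (y * a i)).
  move=> /le_eqVlt[<- Kx|q1]; first by exists x; rewrite ?mul1g // lexx.
  by apply: shift1; rewrite cone_lt.
(* If y <= m0^r, write m0^r = y q with q >= 1 and shift the orbit by q. *)
have push y x r : K x -> le y (m0 ^+ r) -> le (y * (x * a i)) (m0 ^+ r.+1).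
  move=> Kx ley.
  have [|z Kz lez] := @shift (y^-1 * m0 ^+ r) x _ Kx.
    by rewrite -(le_inv2l y) mulg1 mulVKg.
  move: lez; rewrite -(le_inv2l y) -mulgA mulVKg => /le_trans; apply.
  by rewrite expgSr le_inv2l; apply: escape.
have gen_le g : tail_set a i g -> exists2 x, K x & le g (x * a i).
  case/gen_cases => [->|/word_positive_tail_group /lt_subgroup_gen /ltW ga];
    by exists 1 => //; rewrite mul1g ?lexx.
(* The bound y is a prefix already read; generalizing over it lets the
   induction follow the word from the left. *)
have powers : forall y r, le y (m0 ^+ r) -> exists s, le (y * m') (m0 ^+ s).
  elim/word_positive_ind: Pm' => {m'} [g /gen_le[x Kx gx] y r yr|].
    exists r.+1; apply: le_trans (push _ _ _ Kx yr).
    by rewrite le_inv2l.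
  move=> g m' /gen_le[x Kx gx] _ IH y r yr; rewrite mulgA; apply: (IH _ r.+1).
  by apply: le_trans (push _ _ _ Kx yr); rewrite le_inv2l.
have [s] := powers 1 0 (lexx 1); rewrite mul1g => m's.
exists (x0 * a i * m0 ^+ s).
  by apply: word_positiveX => //; apply: subgroup_mul_gen.
apply: le_trans m's _; rewrite !mulgA -/m0 -expgS expgSr.
by rewrite -{1}[m0 ^+ s]mulg1 le_inv2l; apply: ltW; apply: pos_gt1 Pm0.
Qed.

Lemma cofinal_gen m' : P m' -> exists2 m, P m & le m' (a i * m).
Proof.
have [absorb|] := pselect (forall x, K x ->
  exists2 y, K y & lt (a i * x * a i) (y * a i)).
  exact: cofinal_absorbed.
move=> /existsNP[x0 /not_implyP[Kx0 esc]].
apply: (cofinal_escaping Kx0) => x Kx.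
by have [//|xl] := le_total (x * a i) (a i * x0 * a i); case: esc; exists x.
Qed.

(** An inverse letter x^-1 is handled by cofinality of x P in P, for x = a_i by
    the previous lemma and for x in K because K acts on the elements that
    contain a_i, while K itself lies below a_i. *)
Lemma tail_group_bounded g : tail_group a i g -> exists2 m, P m & le g m.
Proof.
have [_ KM KV] := subK.
elim=> {g} [|x g ix _ [m Pm gm]|x g ix _ [m Pm gm]].
- by exists (a i) => //; apply: ltW; apply: pos_gt1 Pa.
- exists (x * m); first by apply: PM => //; apply: word_positive_gen.
  by rewrite le_inv2l.
have [{ix}->|/word_positive_tail_group Kx] := gen_cases ix.
  have [m' Pm' mm'] := cofinal_gen Pm; exists m' => //.
  by rewrite -(le_inv2l (a i)) mulVKg; apply: le_trans mm'.
have [Km|im] := positive_cases Pm.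
  exists (a i) => //; apply: (@le_trans (x^-1 * m)); first by rewrite le_inv2l.
  by apply/ltW/lt_subgroup_gen; apply: KM => //; apply: KV.
exists (x^-1 * m); last by rewrite le_inv2l.
by apply: index_positive_word; apply: positive_overMl => //; apply: KV.
Qed.

(** A positive g in K_i that is not in P_i would be u a_j v with j < i, u in
    K_i and v >= 1. Then a_j <= u^-1 g is bounded by an element of P_i, which
    is smaller than a_j. *)
Lemma trichotomous_step : trichotomous i.
Proof.
have [I1 IM IV] := tail_group_subgroup a i.
suff pos g : tail_group a i g -> lt 1 g -> P g.
  move=> g ig; have [g1|] := eqVneq g 1; first by constructor 2.
  have [_ _ tot inv] := ltP; move=> /tot/orP[/(inv g^-1)|g1]; last first.
    by constructor 1; apply: pos.
  by rewrite mulVg mulg1 => g1; constructor 3; apply: pos => //; apply: IV.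
move=> ig g1.
have : word_positive (tail_set a 0) g by rewrite cone_lt.
suff split h : word_positive (tail_set a 0) h -> P h \/
    exists u (j : 'I_n) v,
      [/\ tail_group a i u, (j < i)%N, le 1 v & h = u * (a j * v)].
  move=> /split[//|[u [j [v [iu ji v1 gE]]]]].
  have [|m Pm] := @tail_group_bounded (u^-1 * g).
    by apply: IM => //; apply: IV.
  rewrite gE mulKg => /negP[]; apply: lt_le_trans (lt_positive_gen ji Pm) _.
  by rewrite -{1}[a j]mulg1 le_inv2l.
have gen_split x : tail_set a 0 x ->
    tail_set a i x \/ exists2 j : 'I_n, (j < i)%N & x = a j.
  by move=> [j _ <-]; have [ij|ji] := leqP i j; [left | right]; exists j.
elim/word_positive_ind => {h} [x /gen_split[ix|[j ji ->]]|].
- by left; apply: word_positive_gen.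
- by right; exists 1, j, 1; rewrite mul1g mulg1; split => //; apply: lexx.
move=> x h /gen_split[ix|[j ji ->]] h0 IH; last first.
  right; exists 1, j, h; rewrite mul1g; split => //.
  by apply: ltW; apply: pos_gt1 h0.
case: IH => [Ph|[u [j [v [iu ji v1 ->]]]]].
  by left; apply: PM => //; apply: word_positive_gen.
right; exists (x * u), j, v; split; rewrite ?mulgA //.
by apply: IM => //; apply: span_gen.
Qed.

End Step.

End Trichotomy.

(** * Dehornoy-like and isolated orderings *)

Section Equivalence.
Variables (G : groupType) (n : nat) (s : 'I_n -> G).
Implicit Types (g : G) (i : 'I_n).
Let a := twisted s.

Lemma trichotomous_top k : (n <= k)%N -> trichotomous a k.
Proof. by move=> nk g /(tail_group_trivial nk)->; constructor 2. Qed.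

Lemma trichotomous_descent :
  (forall i, trichotomous a i.+1 -> trichotomous a i) ->
  forall k, trichotomous a k.
Proof.
move=> step k; have [|kn] := leqP n k; first exact: trichotomous_top.
have [d] := ubnP (n - k); elim: d k kn => // d IHd k kn; rewrite ltnS => nkd.
apply: (step (Ordinal kn)) => /=.
have [|k1n] := leqP n k.+1; first exact: trichotomous_top.
by apply: IHd => //; apply: leq_trans nkd; rewrite ltn_sub2l.
Qed.

Lemma property_F_reverses : property_F s -> forall i, reverses_tail a i.
Proof.
move=> sF i g ig; have [i1n|ni1] := ltnP i.+1 n; last first.
  have [j /(leq_trans ni1)] := word_positive_index ig.
  by rewrite leqNgt ltn_ord.
by have [F1 F2] := sF i i1n; split; [apply: F1 | apply: F2]; exists g.
Qed.

Lemma sigma_positive_twisted i g : index_positive a i g ->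
  sigma_positive s g \/ sigma_positive s g^-1.
Proof.
move=> /index_positive_twisted ig.
by case: odd ig => ig; [right|left]; apply/sigma_positiveP; exists i.
Qed.

Lemma index_positive_sigma i g : index_positive s i g ->
  index_positive a i g \/ index_positive a i g^-1.
Proof.
move=> ig; case odd_i : (odd (n - i)); [right|left];
  by apply/index_positive_twisted; rewrite odd_i ?invgK.
Qed.

Lemma index_positive_1 i : index_positive a i 1 <-> index_positive s i 1.
Proof. by rewrite index_positive_twisted invg1 if_same. Qed.

Lemma sigma_positiveM g h :
  sigma_positive s g -> sigma_positive s h -> sigma_positive s (g * h).
Proof.
move=> /sigma_positiveP[i ig] /sigma_positiveP[j jh]; apply/sigma_positiveP.
by have [l [_ lgh]] := index_positiveM ig jh; exists l.
Qed.

Lemma range_tail_set : range a = tail_set a 0.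
Proof. by apply/seteqP; split=> _ [i _ <-]; exists i. Qed.

Hypotheses (s_gen : generates s) (s_F : property_F s).

(** A sigma-positive element of K_i is j-positive for some j. If j < i, its
    inverse lies in the subgroup over which j-positivity is taken and 1 would
    be j-positive; if j > i, the trichotomy at i + 1 applies; if j = i,
    Property F does. *)
Lemma Dehornoy_like_trichotomous : defines_Dehornoy_like s ->
  forall k, trichotomous a k.
Proof.
move=> /cone_of_left_orderingP[_ tot no1]; apply: trichotomous_descent.
move=> i tri_i g ig; have [_ _ IV] := tail_group_subgroup a i.
have half h : tail_group a i h -> sigma_positive s h ->
    [\/ word_positive (tail_set a i) h, h = 1
      | word_positive (tail_set a i) h^-1].
  move=> ih /sigma_positiveP[j jh]; have [ji|ij|eq_ij] := ltngtP j i.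
  - case: no1; apply/sigma_positiveP; exists j; rewrite -(mulgV h).
    apply: positive_overMr => //; first exact: tail_group_subgroup.
    by rewrite -tail_group_twisted; apply: (tail_group_sub ji (IV _ ih)).
  - have : tail_group a i.+1 h.
      by rewrite /a tail_group_twisted; apply: index_positive_tail jh.
    case/tri_i => [h'|->|h']; [constructor 1|by constructor 2|constructor 3];
      exact: tail_set_sub h'.
  - have eij : j = i by apply: val_inj.
    move: jh; rewrite eij => /index_positive_sigma[] h';
      [constructor 1|constructor 3];
      exact: (index_positive_word (@property_F_reverses s_F i) tri_i h').
case: (tot g) => [/(half _ ig)//|->|/(half _ (IV _ ig))].
  by constructor 2.
rewrite invgK; case=> [h|/(canRL invgK)|h].
- by constructor 3.
- by rewrite invg1 => ->; constructor 2.
by constructor 1.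
Qed.

Lemma Dehornoy_like_isolated :
  defines_Dehornoy_like s -> defines_isolated_ordering (range a).
Proof.
move=> sD; have tri := Dehornoy_like_trichotomous sD.
have [lt ltP cone_lt] : cone_of_left_ordering (word_positive (range a)).
  apply/cone_of_left_orderingP; rewrite range_tail_set; split.
  - by move=> g h; apply: word_positiveM.
  - move=> g; apply: tri; rewrite tail_group_twisted.
    exact: generates_tail_group.
  - move=> /word_positive_index[i _ /index_positive_1 i1].
    have /cone_of_left_orderingP[_ _] := sD; apply.
    by apply/sigma_positiveP; exists i.
by exists lt => //; apply: isolated_ordering_fin_gen cone_lt.
Qed.

Lemma isolated_Dehornoy_like :
  defines_isolated_ordering (range a) -> defines_Dehornoy_like s.
Proof.
move=> [lt [ltP _]]; rewrite range_tail_set => cone_lt.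
have rev := property_F_reverses s_F.
have tri : forall k, trichotomous a k.
  by apply: trichotomous_descent => i tri_i; apply: trichotomous_step cone_lt _.
have [_ tot no1] : [/\ forall g h, positive_cone lt g -> positive_cone lt h ->
      positive_cone lt (g * h),
    forall g, [\/ positive_cone lt g, g = 1 | positive_cone lt g^-1]
  & ~ positive_cone lt 1] by apply: positive_coneP.
apply/cone_of_left_orderingP; split.
- by move=> g h; apply: sigma_positiveM.
- have half h : word_positive (tail_set a 0) h ->
      sigma_positive s h \/ sigma_positive s h^-1.
    by move=> /word_positive_index[i _]; apply: sigma_positive_twisted.
  rewrite -cone_lt in tot; move=> g; case: (tot g) => [/half|->|/half].
  + by case=> [h|h]; [constructor 1 | constructor 3].
  + by constructor 2.
  + by rewrite invgK; case=> [h|h]; [constructor 3 | constructor 1].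
move=> /sigma_positiveP[i /index_positive_1 i1]; apply: no1; rewrite -cone_lt.
apply: (@tail_set_sub _ _ _ 0 i) => //.
exact: index_positive_word i1.
Qed.

End Equivalence.

Theorem theorem1 (G : groupType) (n : nat) (s : 'I_n -> G)
    (s_gen : generates s) (s_F : property_F s) :
  defines_Dehornoy_like s <-> defines_isolated_ordering (range (twisted s)).
Proof.
by split; [apply: Dehornoy_like_isolated | apply: isolated_Dehornoy_like].
Qed.
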